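(* Let $n>3$ be an integer and let $W_n=\mathrm{Hom}(V\otimes\mathbb{C}^{n-1},\mathbb{C}^{2n-3})$, whose elements are identified with the morphisms of vector bundles $\mathcal{O}(-2)\otimes\mathbb{C}^{n-1}\to\mathcal{O}(-1)\otimes\mathbb{C}^{2n-3}$ on $\mathbb{P}_2=\mathbb{P}(V)$. If $\phi\in W_n$ is semi-stable, then $\phi$ is injective as a morphism of sheaves.
   Context: $V$ is a 3-dimensional complex vector space, $\mathbb{P}(V)$ is the space of lines in $V$, and $\mathrm{Hom}(\mathcal{O}(-2),\mathcal{O}(-1))=V^*$. An element $\phi\in W_n$ is semi-stable if for all subspaces $M'\subset\mathbb{C}^{n-1}$, $N'\subset\mathbb{C}^{2n-3}$ with $M'\ne\{0\}$, $N'\ne\mathbb{C}^{2n-3}$ and $\phi(V\otimes M')\subset N'$, one has $\frac{\dim N'}{\dim M'}\ge\frac{2n-3}{n-1}$. *)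

(* Defs.v *)
From HB Require Import structures.
From mathcomp Require Import all_boot all_order all_algebra.
From mathcomp Require Import boolp classical_sets reals.
From mathcomp Require Import mpoly complex.

Set Implicit Arguments.
Unset Strict Implicit.
Unset Printing Implicit Defensive.

Import Order.TTheory GRing.Theory Num.Theory.
Local Open Scope ring_scope.

Section KroneckerModules.
Variables (K : closedFieldType) (V : vectType K).

(* V (x) K^k is realised as V^k, the tensor v (x) m having components m_i v. *)
Definition tens k (v : V) (m : 'cV[K]_k) : {ffun 'I_k -> V} :=
  [ffun i => m i 0 *: v].

(* The subspace V (x) M' of V (x) K^k. *)
Definition tensv k (M' : {vspace 'cV[K]_k}) : {vspace {ffun 'I_k -> V}} :=
  <<[seq tens v m | v <- vbasis {:V}, m <- vbasis M']>>%VS.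

Definition W (n : nat) :=
  'Hom({ffun 'I_(n - 1) -> V}, 'cV[K]_(2 * n - 3)).

Definition semistable n (phi : W n) : Prop :=
  forall (M' : {vspace 'cV[K]_(n - 1)}) (N' : {vspace 'cV[K]_(2 * n - 3)}),
    M' != 0%VS -> N' != fullv -> (phi @: tensv M' <= N')%VS ->
    (2 * n - 3)%:R / (n - 1)%:R <= (\dim N')%:R / (\dim M')%:R :> rat.

End KroneckerModules.

Section ProjectiveSpace.
Variables (K : closedFieldType) (V : vectType K).

Definition proj := {L : {vspace V} | \dim L == 1%N}.

(* Polynomials in the coordinates relative to a fixed basis of V, evaluated at
   vectors of V. *)
Definition hval (p : {mpoly K[\dim {:V}]}) (v : V) : K :=
  p.@[fun i => coord (vbasis {:V}) i v].

(* Closed sets are the zero loci of sets of homogeneous polynomials. *)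
Definition zariski_closed (Z : set proj) : Prop :=
  exists S : set {mpoly K[\dim {:V}]},
    (forall p, S p -> exists d : nat, p \is d.-homog) /\
    (forall L : proj, Z L <->
       forall p, S p -> forall v, v \in val L -> hval p v = 0).

Definition zariski_open (U : set proj) : Prop := zariski_closed (~` U)%classic.

Definition in_cone (U : set proj) (v : V) : Prop :=
  v != 0 /\ exists2 L : proj, U L & v \in val L.

(* The nonzero vectors of the lines in U. *)
Definition cone (U : set proj) := {v : V | in_cone U v}.

(* As P(V) is the space of lines of V, O(-1) is the tautological line bundle.
   A section of O(d) (x) K^k over U is a K^k-valued function on the cone over U
   which is, locally on U, a quotient of homogeneous polynomials whose degrees
   differ by d (hence homogeneous of degree d); for d = - e, the function s
   stands for the section with value v^(x)e (x) s(v) at the line <[v]>. *)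
Definition regular (d : int) k (U : set proj) (s : cone U -> 'cV[K]_k) : Prop :=
  forall L : proj, U L ->
  exists (U' : set proj) (d1 d2 : nat)
         (f : 'I_k -> {mpoly K[\dim {:V}]}) (g : {mpoly K[\dim {:V}]}),
    [/\ zariski_open U' /\ U' L,
        d1%:Z - d2%:Z = d,
        (forall i, f i \is d1.-homog) /\ g \is d2.-homog &
        forall y : cone U, in_cone U' (sval y) ->
          hval g (sval y) != 0 /\
          forall i, s y i 0 = hval (f i) (sval y) / hval g (sval y)].

Record sections (d : int) k (U : set proj) := Sections {
  section_fun :> cone U -> 'cV[K]_k;
  section_regular : regular d section_fun }.

End ProjectiveSpace.

Section SheafMorphism.
Variables (K : closedFieldType) (V : vectType K).

(* At the line <[v]> the sheaf morphism attached to phi sends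
   v (x) v (x) m to v (x) phi(v (x) m). *)
Definition sheaf_map_fun n (phi : W V n) (U : set (proj V))
    (s : cone U -> 'cV[K]_(n - 1)) (y : cone U) : 'cV[K]_(2 * n - 3) :=
  phi (tens (sval y) (s y)).

Lemma sheaf_map_regular n (phi : W V n) (U : set (proj V))
    (s : cone U -> 'cV[K]_(n - 1)) :
  regular (-2) s -> regular (-1) (sheaf_map_fun phi s).
Proof.
move=> sreg L UL.
have [U' [d1 [d2 [f [g [U'L abd [fh gh] sE]]]]]] := sreg L UL.
pose c i j l := phi (tens (vbasis {:V})`_l (delta_mx i 0)) j 0.
exists U', d1.+1, d2, (fun j => \sum_i \sum_(l < \dim {:V}) c i j l *: ('X_l * f i)), g.
split=> //.
- by rewrite -add1n PoszD -addrA abd.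
- split=> // j; apply: rpred_sum => i _; apply: rpred_sum => l _.
  apply: rpredZ; rewrite -add1n; apply: dhomogM => //.
  by rewrite dhomogX /= mdeg1.
move=> y U'y; have [gy0 sy] := sE y U'y; split=> // j.
have tE : tens (sval y) (s y) = \sum_i \sum_(l < \dim {:V})
    (s y i 0 * coord (vbasis {:V}) l (sval y))
      *: tens (vbasis {:V})`_l (delta_mx i 0).
  apply/ffunP => i; rewrite sum_ffunE ffunE (bigD1 i) //= [X in _ + X]big1 ?addr0.
    rewrite sum_ffunE {1}(coord_vbasis (memvf (sval y))) scaler_sumr.
    apply: eq_bigr => l _.
    by rewrite !ffunE mxE !eqxx scale1r scalerA.
  move=> i' i'i; rewrite sum_ffunE big1 // => l _.
  by rewrite !ffunE mxE eq_sym (negPf i'i) scale0r scaler0.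
rewrite /sheaf_map_fun tE linear_sum summxE /hval raddf_sum mulr_suml.
apply: eq_bigr => i _ /=; rewrite linear_sum summxE raddf_sum mulr_suml.
apply: eq_bigr => l _ /=.
rewrite linearZ mxE mevalZ mevalM mevalXU sy -/(c i j l) /hval.
by rewrite mulrC -!mulrA; congr (_ * _); rewrite [LHS]mulrA [LHS]mulrC.
Qed.

Definition sheaf_map n (phi : W V n) (U : set (proj V))
    (s : sections (-2) (n - 1) U) : sections (-1) (2 * n - 3) U :=
  Sections (sheaf_map_regular phi (section_regular s)).

Definition sheaf_injective n (phi : W V n) : Prop :=
  forall U : set (proj V), zariski_open U -> injective (@sheaf_map n phi U).

End SheafMorphism.

(* Main.v *)
(* Write phi_v for the linear map m |-> phi (v (x) m).  If the sheaf morphism is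
   not injective, a section of the kernel gives polynomial functions f with
   phi_v (f v) = 0 for all v and f v0 != 0 for some v0.  Complete v0 to a basis
   v0, v1, v2 of V.  On the pencil v0 + t v1 the coefficients of f (v0 + t v1)
   span a subspace M with phi_v1 M <= phi_v0 M and dim (phi_v0 M) < dim M =: m.
   Take z = v0 + t v2 with t != 0 and f z != 0, so that phi_z is not injective.
   Then phi (V (x) M) = phi_v0 M + phi_z M has dimension at most 2m - 1, and at
   most 2m - 2 if M is all of K^(n - 1); both contradict semi-stability. *)

From HB Require Import structures.
Require Import Defs.
From mathcomp Require Import all_boot all_order all_algebra.
From mathcomp Require Import reals complex.
From mathcomp Require Import boolp classical_sets mpoly zify.

Set Implicit Arguments.
Unset Strict Implicit.
Unset Printing Implicit Defensive.

Import Order.TTheory GRing.Theory Num.Theory.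
Local Open Scope ring_scope.

(** * Slices of a Kronecker module at vectors of [V] *)

Section Slices.
Variables (K : closedFieldType) (V : vectType K) (k p : nat).
Implicit Types (phi : 'Hom({ffun 'I_k -> V}, 'cV[K]_p)) (v w : V).

Lemma tens_is_linear v : linear (@tens K V k v).
Proof.
by move=> a m m'; apply/ffunP=> i; rewrite !ffunE !mxE scalerDl scalerA.
Qed.
HB.instance Definition _ v := GRing.isLinear.Build K 'cV[K]_k
  {ffun 'I_k -> V} *:%R (@tens K V k v) (tens_is_linear v).

Lemma tens_linearl a v b w (m : 'cV[K]_k) :
  tens (a *: v + b *: w) m = a *: tens v m + b *: tens w m.
Proof.
apply/ffunP=> i; rewrite !ffunE scalerDr !scalerA.
by rewrite [a * _]mulrC [b * _]mulrC.
Qed.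

Definition slice phi v : 'Hom('cV[K]_k, 'cV[K]_p) := linfun (phi \o tens v).

Lemma sliceE phi v m : slice phi v m = phi (tens v m).
Proof. by rewrite lfunE. Qed.

Lemma slice_linear phi a v b w :
  slice phi (a *: v + b *: w) = a *: slice phi v + b *: slice phi w.
Proof.
apply/lfunP=> m.
by rewrite add_lfunE !scale_lfunE !sliceE tens_linearl linearD !linearZ.
Qed.

Lemma slice0 phi : slice phi 0 = 0.
Proof. by have := slice_linear phi 0 0 0 0; rewrite !scale0r !addr0. Qed.

(** Pure tensors span [tensv V M], so the inclusion in the definition of semi-stability can be
    tested slice by slice. *)
Lemma slice_tensv phi (M : {vspace 'cV[K]_k}) (N : {vspace 'cV[K]_p}) :
  (forall v, (slice phi v @: M <= N)%VS) -> (phi @: tensv V M <= N)%VS.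
Proof.
move=> MN; rewrite limg_span; apply/span_subvP.
move=> _ /mapP[_ /allpairsP[[v m] /= [_ mM ->]] ->].
rewrite -sliceE; apply: (subvP (MN v)).
exact/memv_img/vbasis_mem.
Qed.

End Slices.

(** * Singular pencils of linear maps *)

Lemma dim_limg_lt (K : fieldType) (aT rT : vectType K) (f : 'Hom(aT, rT))
    (U : {vspace aT}) u :
  u \in U -> u != 0 -> f u = 0 -> (\dim (f @: U) < \dim U)%N.
Proof.
move=> uU u0 fu; rewrite -(limg_ker_dim f U) -[X in (X < _)%N]add0n ltn_add2r.
rewrite lt0n dimv_eq0; apply/eqP=> UK; have : u \in (U :&: lker f)%VS.
  by rewrite memv_cap uU memv_ker fu eqxx.
by rewrite UK memv0 (negPf u0).
Qed.

(* Writing the kernel vector as [\sum_l t^l c_l], the equations [A c_0 = 0] and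
   [A c_(l+1) = - B c_l] show that the span M of the [c_l] works. *)
Lemma singular_pencil (K : closedFieldType) k p
    (A B : 'Hom('cV[K]_k, 'cV[K]_p)) (F : 'I_k -> {poly K}) (Q : {poly K}) i0 :
    Q != 0 -> (F i0).[0] != 0 ->
    (forall t, Q.[t] != 0 -> (A + t *: B) (\col_i (F i).[t]) = 0) ->
  exists M : {vspace 'cV[K]_k},
    (B @: M <= A @: M)%VS /\ (\dim (A @: M) < \dim M)%N.
Proof.
move=> Q0 Fi0 ABF; pose c l : 'cV[K]_k := \col_i (F i)`_l.
pose D := \max_i size (F i).
have sF i : (size (F i) <= D)%N by apply: leq_bigmax.
have cD : c D = 0 by apply/colP=> i; rewrite !mxE nth_default.
(* [e l] is the coefficient of t^l in (A + tB)F(t); in degree 0 the factor t leaves no [B] term. *)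
pose e l := A (c l) + (if l is l'.+1 then B (c l') else 0).
have colF t : \col_i (F i).[t] = \sum_(l < D) t ^+ l *: c l.
  apply/colP=> i; rewrite mxE summxE (horner_coef_wide _ (sF i)).
  by apply: eq_bigr => l _; rewrite !mxE mulrC.
have eE t : (A + t *: B) (\col_i (F i).[t]) = \sum_(l < D.+1) t ^+ l *: e l.
  rewrite (eq_bigr (fun l : 'I_D.+1 => t ^+ l *: A (c l) +
    t ^+ l *: if l : nat is l'.+1 then B (c l') else 0)); last first.
    by move=> l _; rewrite scalerDr.
  rewrite big_split /= big_ord_recr /= cD linear0 scaler0 addr0.
  rewrite [X in _ = _ + X]big_ord_recl /= scaler0 add0r.
  rewrite add_lfunE scale_lfunE colF.
  rewrite !linear_sum.
  congr (_ + _); apply: eq_bigr => l _; first by rewrite linearZ.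
  by rewrite /= linearZ /= scalerA -exprS.
have e0 l : (l <= D)%N -> e l = 0.
  move=> lD; apply/colP=> j; rewrite [RHS]mxE.
  (* [G] is the j-th coordinate of (A + tB)F(t). It vanishes wherever [Q] does not, so a non-root of
     [Q * G] would be absurd. *)
  pose G := \poly_(l < D.+1) e l j 0.
  suff G0 : G = 0 by have := coef_poly D.+1 (fun l => e l j 0) l;
    rewrite -/G G0 coef0 ltnS lD => <-.
  apply/eqP; apply: contraT => Gn0.
  have /closed_nonrootP[t] : Q * G != 0 by rewrite mulf_neq0.
  rewrite rootM negb_or => /andP[Qt /negP[]]; rewrite rootE horner_poly.
  have /colP/(_ j) := ABF t Qt; rewrite eE summxE [RHS]mxE => G0.
  apply/eqP; rewrite -[RHS]G0; apply: eq_bigr => l' _.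
  by rewrite [RHS]mxE mulrC.
pose M := <<mkseq c D>>%VS.
have cM l : c l \in M.
  have [lD|Dl] := ltnP l D.
    by apply/memv_span/mapP; exists l; rewrite ?mem_iota.
  suff -> : c l = 0 by apply: mem0v.
  by apply/colP=> i; rewrite !mxE nth_default // (leq_trans (sF i)).
exists M; split.
  (* [B (c l) = - A (c l.+1)], and [c l.+1] stays in [M] even for the last generator, as
     [c D = 0]. *)
  rewrite [X in (X <= _)%VS]limg_span; apply/span_subvP.
  move=> _ /mapP[_ /mapP[l l_D ->] ->].
  have /eqP : e l.+1 = 0 by apply: e0; rewrite mem_iota in l_D.
  rewrite /e addrC addr_eq0 => /eqP ->.
  by rewrite memvN memv_img.
apply: (@dim_limg_lt _ _ _ _ _ (c 0%N)) => //.
  apply: contraNneq Fi0 => /colP/(_ i0); rewrite !mxE => F0.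
  by rewrite horner_coef0 F0.
by have := e0 0%N (leq0n _); rewrite /e addr0.
Qed.

(** * Polynomial functions on [V] and open sets of P(V) *)

Section Values.
Variables (K : closedFieldType) (V : vectType K).
Implicit Types (q : {mpoly K[\dim {:V}]}) (v w : V) (U : set (proj V)).

Lemma hvalM q q' v : hval (q * q') v = hval q v * hval q' v.
Proof. exact: mevalM. Qed.

Lemma hvalB q q' v : hval (q - q') v = hval q v - hval q' v.
Proof. exact: mevalB. Qed.

Lemma hval_line q v w : {Q : {poly K} | forall t, Q.[t] = hval q (v + t *: w)}.
Proof.
pose h i := (coord (vbasis {:V}) i v)%:P + (coord (vbasis {:V}) i w)%:P * 'X.
exists (mmap polyC h q) => t; rewrite /hval mevalE horner_sum.
apply: eq_bigr => m _; rewrite hornerM hornerC horner_prod; congr (_ * _).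
apply: eq_bigr => i _.
by rewrite horner_exp !hornerE linearD linearZ /= [t * _]mulrC.
Qed.

Lemma hval_homog q d a v :
  q \is d.-homog -> hval q (a *: v) = a ^+ d * hval q v.
Proof.
move=> /dhomogP qd; rewrite /hval !mevalE mulr_sumr big_seq [RHS]big_seq.
apply: eq_bigr => m /qd <-; rewrite mulrCA; congr (_ * _).
rewrite /= mdegE -prodrXr -big_split.
by apply: eq_bigr => i _; rewrite linearZ exprMn.
Qed.

Lemma proj_line (L : proj V) v : v != 0 -> v \in val L -> val L = <[v]>%VS.
Proof.
move=> v0 vL; apply/esym/eqP; rewrite eqEdim -memvE vL dim_vline v0.
by rewrite (eqP (valP L)).
Qed.

(** Some homogeneous equation of the complement does not vanish identically on the line of [v],
    hence by homogeneity not at [v]; its non-vanishing locus lies in the cone. *)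
Lemma open_cone U v : zariski_open U -> in_cone U v ->
  exists2 q, hval q v != 0 &
    forall w, w != 0 -> hval q w != 0 -> in_cone U w.
Proof.
move=> [S [Shom SU]] [v0 [L UL vL]].
have [q [Sq qv]] : exists q, S q /\ hval q v != 0.
  apply: contrapT => noq; suff : (~` U)%classic L by [].
  apply/SU => q Sq u; rewrite (proj_line v0 vL) => /vlineP[a ->].
  have [d /hval_homog ->] := Shom q Sq.
  have [-> | qv] := eqVneq (hval q v) 0; first by rewrite mulr0.
  by case: noq; exists q.
exists q => // w w0 qw; split=> //.
have dw : \dim <[w]> == 1%N by rewrite dim_vline w0.
exists (exist _ <[w]>%VS dw); last exact: memv_line.
apply: contrapT => /SU/(_ q Sq w (memv_line w))/eqP.
by rewrite (negPf qw).
Qed.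

End Values.

(** * From a polynomial kernel vector to a destabilising subspace *)

Lemma basis3 (K : fieldType) (V : vectType K) (v : V) :
    \dim {:V} = 3%N -> v != 0 ->
  exists v1 v2, forall u, exists a b c, u = a *: v + b *: v1 + c *: v2.
Proof.
move=> dimV v0.
have extend (X : {vspace V}) :
    (\dim X < 3)%N -> exists2 u, u \notin X & \dim (X + <[u]>) = (\dim X).+1.
  rewrite -dimV => dX; have : ~~ (fullv <= X)%VS.
    by apply: contraL dX => /dimvS; rewrite -leqNgt.
  case/subvPn=> u _ uX; exists u => //.
  rewrite dimv_disjoint_sum ?dim_vline.
    suff -> : u != 0 by rewrite addn1.
    by apply: contraNneq uX => ->; apply: mem0v.
  apply/eqP; rewrite -subv0; apply/subvP=> x /memv_capP[xX /vlineP[a xE]].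
  have [a0|a0] := eqVneq a 0; first by rewrite xE a0 scale0r mem0v.
  by case/negP: uX; rewrite -(scale1r u) -(mulVf a0) -scalerA -xE memvZ.
have [|v1 _ d1] := extend <[v]>%VS; first by rewrite dim_vline v0.
have [|v2 _ d2] := extend (<[v]> + <[v1]>)%VS; first by rewrite d1 dim_vline v0.
exists v1, v2 => u.
have /memv_addP[x /memv_addP[_ /vlineP[a ->] [_ /vlineP[b ->] ->]]] :
    u \in (<[v]> + <[v1]> + <[v2]>)%VS.
  suff /eqP -> : (<[v]> + <[v1]> + <[v2]>)%VS == fullv by apply: memvf.
  by rewrite eqEdim subvf dimV d2 d1 dim_vline v0.
by case=> _ /vlineP[c ->] ->; exists a, b, c.
Qed.

(** Here [f] plays the role of a kernel section with denominators cleared, and [q] cuts out a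
    principal open set on which it is defined. *)
Lemma semistable_kernel (K : closedFieldType) (V : vectType K) n (phi : W V n)
    (f : 'I_(n - 1) -> {mpoly K[\dim {:V}]}) (q : {mpoly K[\dim {:V}]}) v i :
    \dim {:V} = 3%N -> (3 < n)%N -> semistable phi ->
    v != 0 -> hval q v != 0 -> hval (f i) v != 0 ->
    ~ (forall w, hval q w != 0 -> slice phi w (\col_j hval (f j) w) = 0).
Proof.
move=> dimV n3 ss v0 qv fv ker.
have [v1 [v2 vE]] := basis3 dimV v0.
have [M [BA dA]] : exists M : {vspace 'cV[K]_(n - 1)},
    (slice phi v1 @: M <= slice phi v @: M)%VS /\
    (\dim (slice phi v @: M) < \dim M)%N.
  have [Q QE] := hval_line q v v1.
  pose F j := sval (hval_line (f j) v v1).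
  have FE j t : (F j).[t] = hval (f j) (v + t *: v1).
    by rewrite /F; case: hval_line.
  apply: (@singular_pencil _ _ _ _ _ F Q i).
  - apply: contraNneq qv => Q0.
    by rewrite -[v]addr0 -(scale0r v1) -QE Q0 horner0.
  - by rewrite FE scale0r addr0.
  move=> t; rewrite QE => /ker.
  rewrite -{1}[v]scale1r slice_linear scale1r => <-; congr (fun_of_lfun _ _).
  by apply/colP=> j; rewrite !mxE FE.
have [t t0 [m m0 mz]] : exists2 t, t != 0 &
    exists2 m, m != 0 & slice phi (v + t *: v2) m = 0.
  have [Q QE] := hval_line q v v2; have [F FE] := hval_line (f i) v v2.
  (* One non-root of the product meets all three demands on [t]; [Q] and [F] are non-zero because
     their values at 0 are. *)
  have /closed_nonrootP[t] : 'X * Q * F != 0.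
    have nz P u : hval u v != 0 -> (forall t, P.[t] = hval u (v + t *: v2)) ->
        P != 0.
      move=> uv PE; apply: contraNneq uv => P0.
      by rewrite -[v]addr0 -(scale0r v2) -PE P0 horner0.
    by rewrite !mulf_neq0 ?polyX_eq0 ?(nz _ _ qv QE) ?(nz _ _ fv FE).
  rewrite !rootM !negb_or !rootE hornerX QE FE => /andP[/andP[t0 qt] ft].
  exists t => //; exists (\col_j hval (f j) (v + t *: v2)); last exact: ker.
  by apply: contraNneq ft => /colP/(_ i); rewrite !mxE => ->.
set A := slice phi v in BA dA *; set B := slice phi v1 in BA.
set C := slice phi (v + t *: v2) in mz.
have MN : (phi @: tensv V M <= A @: M + C @: M)%VS.
  apply: slice_tensv => u; have [a [b [c ->]]] := vE u.
  (* With z = v + t v2, substitute v2 = (z - v)/t; the slice at [v1] is then absorbed by [BA]. *)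
  have -> : a *: v + b *: v1 + c *: v2 =
      1 *: ((a - c / t) *: v + b *: v1) + (c / t) *: (v + t *: v2).
    rewrite scale1r scalerDr scalerA divfK // scalerBl addrA; congr (_ + _).
    by rewrite addrAC subrK.
  rewrite !slice_linear scale1r -/A -/B -/C.
  apply/subvP=> _ /memv_imgP[x xM ->].
  rewrite !(add_lfunE, scale_lfunE) memv_add // ?memvZ ?memv_img //.
  by rewrite memvD ?memvZ ?memv_img // (subvP BA) ?memv_img.
have dN := leq_of_leqif (dimv_add_leqif (A @: M) (C @: M)).
have dC : (\dim (C @: M) <= \dim M)%N by rewrite -(limg_ker_dim C M) leq_addl.
have dM : (\dim M <= n - 1)%N.
  by rewrite (leq_trans (dimvS (subvf M))) // dimvf dim_matrix mulr1.
have dfull : \dim {:'cV[K]_(2 * n - 3)} = (2 * n - 3)%N.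
  by rewrite dimvf dim_matrix mulr1.
(* The kernel vector [m] of [C] is known to lie in [M] only when [M] is the whole space. *)
have dC' : \dim M = (n - 1)%N -> (\dim (C @: M) < n - 1)%N.
  move=> Mn; have MT : M = fullv.
    by apply/eqP; rewrite eqEdim subvf Mn dimvf dim_matrix mulr1 /=.
  by rewrite -[X in (_ < X)%N]Mn (dim_limg_lt _ m0 mz) // MT memvf.
(* The bound is 2(n - 2) if [M] is everything, and at most 2(n - 2) - 1 otherwise. *)
have Nle : (\dim (A @: M + C @: M) < 2 * n - 3)%N by lia.
have M0 : M != 0%VS by rewrite -dimv_eq0 -lt0n; lia.
have Nn : (A @: M + C @: M)%VS != fullv.
  by apply: contraTneq Nle => ->; rewrite dfull ltnn.
have := ss _ _ M0 Nn MN.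
rewrite ler_pdivrMr ?ltr0n; last lia.
rewrite mulrAC ler_pdivlMr ?ltr0n ?lt0n ?dimv_eq0 // -!natrM ler_nat.
apply/negP; rewrite -ltnNge.
have [Mn|Mn] := eqVneq (\dim M) (n - 1)%N.
  by rewrite {1}Mn ltn_pmul2r //; lia.
have dN2 : (\dim (A @: M + C @: M) <= 2 * \dim M - 1)%N by lia.
apply: leq_ltn_trans (leq_mul dN2 (leqnn _)) _.
(* With k = n - 1 and m = [\dim M], (2m - 1)k < (2k - 1)m amounts to m < k. *)
have -> : (2 * n - 3 = 2 * (n - 1) - 1)%N by lia.
have : (\dim M < n - 1)%N by lia.
by rewrite !mulnBl !mul1n mulnAC => dMn; rewrite ltn_sub2l //; nia.
Qed.

(** * Reduction from sections to polynomials *)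

Theorem proposition5p4 (R : realType) (V : vectType R[i])
    (dimV : \dim {: V} = 3%N) (n : nat) (n_gt3 : (3 < n)%N) (phi : W V n)
    (phi_ss : semistable phi) :
  sheaf_injective phi.
Proof.
move=> U oU s1 s2 eq12.
suff : section_fun s1 = section_fun s2.
  case: s1 s2 {eq12} => [s1 r1] [s2 r2] /= s12; move: r1 r2; rewrite s12.
  by move=> r1 r2; congr Sections; apply: Prop_irrelevance.
apply/funext => y; apply/colP=> i; apply/eqP; apply: contraT => ns.
have [v0 [L UL vL]] := svalP y.
have [U1 [a1 [b1 [f1 [g1 [[oU1 U1L] _ _ s1E]]]]]] := section_regular s1 UL.
have [U2 [a2 [b2 [f2 [g2 [[oU2 U2L] _ _ s2E]]]]]] := section_regular s2 UL.
have inU (X : set (proj V)) : X L -> in_cone X (sval y).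
  by move=> XL; split=> //; exists L.
have [q qv qU] := open_cone oU (inU _ UL).
have [q1 q1v qU1] := open_cone oU1 (inU _ U1L).
have [q2 q2v qU2] := open_cone oU2 (inU _ U2L).
(* The numerator of [s1 - s2] over the common denominator [g1 * g2]. *)
pose f j := f1 j * g2 - f2 j * g1.
have fE (x : cone U) : in_cone U1 (sval x) -> in_cone U2 (sval x) ->
    \col_j hval (f j) (sval x) =
      (hval g1 (sval x) * hval g2 (sval x)) *: (s1 x - s2 x)
    /\ hval g1 (sval x) * hval g2 (sval x) != 0.
  move=> /s1E[g10 s1x] /s2E[g20 s2x]; split; last by rewrite mulf_neq0.
  apply/colP=> j; rewrite !mxE s1x s2x hvalB !hvalM mulrBr; congr (_ - _).
    by rewrite mulrAC mulrCA divff // mulr1 mulrC.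
  by rewrite -mulrA [hval g2 _ * _]mulrC divfK // mulrC.
have [fy gy] := fE y (inU _ U1L) (inU _ U2L).
case: (@semistable_kernel _ _ _ phi f (q * q1 * q2) (sval y) i) => //.
- by rewrite !hvalM !mulf_neq0.
- have /colP/(_ i) := fy; rewrite !mxE => ->.
  by rewrite mulf_neq0 // subr_eq0.
move=> w; rewrite !hvalM !mulf_eq0 !negb_or => /andP[/andP[qw q1w] q2w].
(* The cones contain only non-zero vectors, so w = 0 is treated apart: its slice is zero. *)
have [->|w0] := eqVneq w 0.
  by rewrite slice0 lfunE.
pose x : cone U := exist _ w (qU w w0 qw).
have [-> _] := fE x (qU1 w w0 q1w) (qU2 w w0 q2w).
rewrite linearZ linearB /= !sliceE.
have := congr1 (fun s => section_fun s x) eq12.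
by rewrite /= /sheaf_map_fun /= => ->; rewrite subrr scaler0.
Qed.
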